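(* Let $k$ be an algebraically closed field of characteristic $p>0$, let $n\ge 2$, and let $f$ be a reduced homogeneous polynomial of degree $d\geq 2$ in $k[x_1,\dots,x_n]$. Then $$\mathrm{fpt}(f)\geq \left[\tfrac{2}{d}\right]_e,$$ where $e$ is the minimal positive integer such that $\left[\frac{2}{d}\right]_e\neq 0$.
   Context: A nonzero homogeneous polynomial is reduced if it has no repeated irreducible factors. For a nonzero homogeneous $f\in k[x_1,\dots,x_n]$ of positive degree, with $\mathfrak m^{[p^e]}=(x_1^{p^e},\dots,x_n^{p^e})$, $\mathrm{fpt}(f)=\sup\{N/p^e : f^N\notin \mathfrak m^{[p^e]}\}=\inf\{N/p^e: f^N\in\mathfrak m^{[p^e]}\}$. For a positive rational $\lambda$, $[\lambda]_e$ denotes the truncation at the $e$-th spot of the possibly-terminating base $p$ expansion of $\lambda$ (if $\lambda$ has two base $p$ expansions, choose the one that terminates); equivalently $[\lambda]_e=\lfloor p^e\lambda\rfloor/p^e$. *)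

(* Defs.v *)
From mathcomp Require Import all_boot all_order all_algebra.
From mathcomp Require Import classical_sets reals.
From mathcomp Require Import mpoly.

Set Implicit Arguments.
Unset Strict Implicit.
Unset Printing Implicit Defensive.

Import Order.TTheory GRing.Theory Num.Theory.
Local Open Scope ring_scope.

Definition mirreducible (k : fieldType) (n : nat) (g : {mpoly k[n]}) : Prop :=
  [/\ g != 0, g \isn't a GRing.unit &
    forall a b : {mpoly k[n]},
      g = a * b -> a \is a GRing.unit \/ b \is a GRing.unit].

Definition reduced (k : fieldType) (n : nat) (f : {mpoly k[n]}) : Prop :=
  f != 0 /\
  forall g : {mpoly k[n]},
    mirreducible g -> ~ exists h : {mpoly k[n]}, f = g ^+ 2 * h.

(* Membership in the ideal (x_1^q, ..., x_n^q); for q = p ^ e this is the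
   Frobenius power of the homogeneous maximal ideal. *)
Definition in_power_ideal (k : fieldType) (n q : nat) (f : {mpoly k[n]}) :
    Prop :=
  exists c : 'I_n -> {mpoly k[n]}, f = \sum_(i < n) c i * 'X_i ^+ q.

(* When k has characteristic p and f is homogeneous of positive degree, the set
   contains 0 (take N = e = 0) and is bounded by 1 (f ^+ (p ^ e) lies in the
   ideal), so that [sup] does not take its default value. *)
Definition fpt (R : realType) (k : fieldType) (n p : nat) (f : {mpoly k[n]}) :
    R :=
  sup (fun x : R => exists N e : nat,
         x = N%:R / (p ^ e)%:R /\ ~ in_power_ideal (p ^ e) (f ^+ N)).

(* The truncation at the e-th spot of the base p expansion of x (the terminating
   one, if x has two). *)
Definition trunc_base (R : realType) (p e : nat) (x : R) : R :=
  (Num.floor ((p ^ e)%:R * x))%:~R / (p ^ e)%:R.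

(* Main.v *)
Require Import Defs.
From mathcomp Require Import all_boot all_order all_algebra.
From mathcomp Require Import classical_sets reals.
From mathcomp Require Import mpoly.
From mathcomp Require Import boolp zify.

Import Order.TTheory GRing.Theory Num.Theory.
Local Open Scope ring_scope.

(* Put q = p^e and N = floor(2q/d); minimality of e gives N <= p.  It suffices
   that f^(N p^s - 1) is not in (x_1^Q, ..., x_n^Q), Q = q p^s, for all s.
   Suppose f^M = sum_i A_i x_i^Q with M = N p^s - 1 and deg A_i <= dM - Q.
   Every derivation D kills x_i^Q, so sum_i (f D(A_i) - M D(f) A_i) x_i^Q = 0;
   as d(M+1) <= 2Q, these coefficients have degree < Q, hence vanish.  With
   r = M mod p this says that f^(p-r) A_i is killed by all derivations, hence
   is a p-th power since k is perfect, and f reduced then yields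
   A_i = f^r a_i^p.  If s > 0 then r = p - 1; cancelling f^r and extracting p-th
   roots gives the same membership for s - 1.  If s = 0 then r = M, and
   cancelling f^M puts 1 in the ideal.  That a reduced f divides g as soon as it
   divides g^p is unique factorization in k[x_1, ..., x_n] (Gauss' lemma). *)

Set Implicit Arguments.
Unset Strict Implicit.
Unset Printing Implicit Defensive.

(** * Unique factorization *)

Definition divides (R : comNzRingType) (a b : R) : Prop := exists c, b = a * c.

Definition prime_elem (R : idomainType) (x : R) : Prop :=
  [/\ x != 0, x \isn't a GRing.unit &
    forall a b, divides x (a * b) -> divides x a \/ divides x b].

(** The index counts the prime factors; [primitive_decomp] uses it as its induction measure. *)
Inductive prime_prod (R : idomainType) : nat -> R -> Prop :=
| PrimeProdUnit u : u \is a GRing.unit -> prime_prod 0 u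
| PrimeProdMul n x a :
    prime_elem x -> prime_prod n a -> prime_prod n.+1 (x * a).

Definition factorial_ring (R : idomainType) : Prop :=
  forall a : R, a != 0 -> exists n, prime_prod n a.

Section Divides.
Variable R : comNzRingType.
Implicit Types a b c : R.

Lemma divides_mulr {a b} c : divides a b -> divides a (b * c).
Proof. by move=> [q ->]; exists (q * c); rewrite mulrA. Qed.

Lemma divides_mull {a b} c : divides a b -> divides a (c * b).
Proof. by rewrite mulrC; apply: divides_mulr. Qed.

Lemma divides_add {a b c} : divides a b -> divides a c -> divides a (b + c).
Proof. by move=> [q ->] [r ->]; exists (q + r); rewrite mulrDr. Qed.

End Divides.

Section Factorial.
Variable R : idomainType.
Implicit Types a b c u x : R.

Lemma prime_prod_mulu {n a u} :
  u \is a GRing.unit -> prime_prod n a -> prime_prod n (u * a).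
Proof.
move=> uu pa; elim: pa => [v uv|m x b px _ IH].
  by apply: PrimeProdUnit; rewrite unitrM uu.
by rewrite mulrCA; apply: PrimeProdMul.
Qed.

Lemma prime_prod_mul {n m a b} :
  prime_prod n a -> prime_prod m b -> prime_prod (n + m) (a * b).
Proof.
move=> pa pb; elim: pa => [u uu|l x c px _ IH]; first exact: prime_prod_mulu.
by rewrite -mulrA addSn; apply: PrimeProdMul.
Qed.

Lemma prime_divides_unit {x} : prime_elem x -> ~ divides x 1.
Proof.
case=> _ /negP ux _ [c e]; apply: ux; apply/unitrP; exists c.
by rewrite mulrC -e.
Qed.

(** The prime x is associated to one of the prime factors of a, and the unit between them is
    absorbed into the remaining product. *)
Lemma prime_prod_div {n x a} : prime_elem x -> prime_prod n a ->
  divides x a -> exists2 b, a = x * b & exists2 m, n = m.+1 & prime_prod m b.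
Proof.
move=> px pa; elim: pa => [u uu [c e]|m y b py pb IH dvd].
  case: (prime_divides_unit px); exists (c * u^-1).
  by rewrite mulrA -e divrr.
have [x0 _ xP] := px; have [y0 _ yP] := py.
case: (xP _ _ dvd) => [[w yE]|dvdb].
  exists (w * b); first by rewrite yE mulrA.
  exists m => //; apply: prime_prod_mulu pb.
  (* Since y = x w is prime, it divides x or w: the first makes w a unit, the second would make x a
     unit. *)
  have: divides y (x * w) by exists 1; rewrite mulr1.
  case/yP => [[v e]|[v e]].
    apply/unitrP; exists v; suff e1 : w * v = 1 by split=> //; rewrite mulrC.
    by apply: (mulfI x0); rewrite mulrA -yE -e mulr1.
  case: (prime_divides_unit px); exists v.
  by apply: (mulfI y0); rewrite mulrCA -e mulr1 [in LHS]yE.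
have [c bE [l -> pc]] := IH dvdb.
exists (y * c); first by rewrite bE mulrCA.
by exists l.+1 => //; apply: PrimeProdMul.
Qed.

Lemma prime_prod_nonunit {n a} : prime_prod n a ->
  a \isn't a GRing.unit -> exists2 x, prime_elem x & divides x a.
Proof.
case=> [u -> //|m x b px _ _]; exists x => //.
by exists b.
Qed.

End Factorial.

(** * Gauss' lemma: polynomials over a factorial ring *)

Section PolyFactorial.
Import Pdiv.Idomain.
Variable R : idomainType.
Hypothesis facR : factorial_ring R.
Implicit Types (c x : R) (p q r : {poly R}).

(** Unit content, phrased through constant divisors so that no gcd has to be chosen in [R]. *)
Definition primitive p : Prop :=
  forall c, divides c%:P p -> c \is a GRing.unit.

Lemma dividesC_coef {c p} : divides c%:P p -> forall i, divides c p`_i.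
Proof. by move=> [q ->] i; exists q`_i; rewrite coefCM. Qed.

(** Induction on the sum of the sizes: x divides the leading coefficient of p q, hence that of p or
    of q, and the corresponding leading term can be subtracted without affecting divisibility by
    x. *)
Lemma prime_polyC {x} : prime_elem x -> prime_elem x%:P.
Proof.
move=> px; have [x0 ux xP] := px; split.
- by rewrite polyC_eq0.
- by rewrite poly_unitE coefC /= (negbTE ux) andbF.
move=> p q; move: {2}(size p + size q)%N (leqnn (size p + size q)) => m.
elim: m p q => [|m IH] p q.
  rewrite leqn0 addn_eq0 size_poly_eq0 => /andP[/eqP -> _] _.
  by left; exists 0; rewrite mulr0.
move=> le_m dvd.
have [->|p0] := eqVneq p 0; first by left; exists 0; rewrite mulr0.
have [->|q0] := eqVneq q 0; first by right; exists 0; rewrite mulr0.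
have step r : r != 0 -> divides x (lead_coef r) ->
    exists2 r' : {poly R}, (size r' < size r)%N & exists t, r = r' + x%:P * t.
  move=> r0 [c cE]; exists (r - x%:P * (c *: 'X^((size r).-1))); last first.
    by exists (c *: 'X^((size r).-1)); rewrite subrK.
  rewrite -mul_polyC mulrA -polyCM -cE mul_polyC.
  rewrite (polySpred r0) ltnS; apply/leq_sizeP => j.
  rewrite leq_eqVlt coefB coefZ coefXn => /predU1P[<-|lt_j].
    by rewrite eqxx mulr1 subrr.
  rewrite gtn_eqF // mulr0 subr0 nth_default //.
  by rewrite (polySpred r0).
have dvdx (t : {poly R}) : divides x%:P (x%:P * t) by exists t.
have := dividesC_coef dvd (size (p * q)).-1.
rewrite -lead_coefE lead_coefM => /xP [/(step _ p0)|/(step _ q0)].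
  move=> [p' lt_p [t pE]].
  have: divides x%:P (p' * q).
    have ->: p' = p + x%:P * (- t) by rewrite pE mulrN addrK.
    rewrite mulrDl; apply: divides_add => //.
    by rewrite -mulrA; apply: dvdx.
  case/IH => [||dvdq]; last by right.
    by rewrite -ltnS (leq_trans _ le_m) // ltn_add2r.
  by move=> dvdp'; left; rewrite pE; apply: divides_add.
move=> [q' lt_q [t qE]].
have: divides x%:P (p * q').
  have ->: q' = q + x%:P * (- t) by rewrite qE mulrN addrK.
  rewrite mulrDr; apply: divides_add => //.
  by rewrite mulrCA; apply: dvdx.
case/IH => [|dvdp|]; [|by left|].
  by rewrite -ltnS (leq_trans _ le_m) // ltn_add2l.
by move=> dvdq'; right; rewrite qE; apply: divides_add.
Qed.

Lemma prime_prod_polyC {n c} : prime_prod n c -> prime_prod n c%:P.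
Proof.
elim=> [u uu|m x b px _ IH]; first by apply: PrimeProdUnit; rewrite rmorph_unit.
by rewrite polyCM; apply: PrimeProdMul => //; apply: prime_polyC.
Qed.

(** A polynomial that is not primitive has a prime constant divisor; dividing by it removes one
    prime factor from the leading coefficient, so the process stops. *)
Lemma primitive_decomp p : p != 0 ->
  exists2 c, c != 0 & exists2 q, primitive q & p = c%:P * q.
Proof.
move=> p0; have lp0 : lead_coef p != 0 by rewrite lead_coef_eq0.
have [n] := facR lp0; elim/ltn_ind: n p {lp0} p0 => n IH p p0 pp.
have [prp|] := pselect (primitive p).
  by exists 1; rewrite ?oner_neq0 //; exists p; rewrite ?mul1r.
move=> /existsNP[c /not_implyP[[q cqE] /negP uc]].
have c0 : c != 0 by apply: contraNneq p0 => c0; rewrite cqE c0 mul0r.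
have [m pc] := facR c0; have [x px [d cE]] := prime_prod_nonunit pc uc.
have pE : p = x%:P * (d%:P * q) by rewrite cqE cE polyCM mulrA.
have := prime_prod_div px pp.
rewrite [in X in divides _ X]pE lead_coefM lead_coefC.
case=> [|b bE [l nE pb]]; first by exists (lead_coef (d%:P * q)).
have x0 : x != 0 by case: px.
have q0 : d%:P * q != 0 by apply: contraNneq p0 => q0; rewrite pE q0 mulr0.
have bE' : lead_coef (d%:P * q) = b.
  by apply: (mulfI x0); rewrite -bE [in RHS]pE lead_coefM lead_coefC.
have lt_ln : (l < n)%N by rewrite nE.
rewrite -bE' in pb; have [c' c'0 [q' prq' qE]] := IH l lt_ln _ q0 pb.
exists (x * c'); first by rewrite mulf_neq0.
by exists q' => //; rewrite pE qE polyCM mulrA.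
Qed.

(** The prime factors of c are cancelled one at a time: each remains prime as a constant, cannot
    divide the primitive p, and so divides the cofactor. *)
Lemma primitive_divides {c p q} : c != 0 -> primitive p ->
  divides p (c%:P * q) -> divides p q.
Proof.
move=> c0 prp; have [n pc] := facR c0.
elim: pc q => [u uu|m x b px _ IH] q [r e].
  exists (u^-1%:P * r); rewrite mulrCA -e mulrA -polyCM mulVr // mul1r //.
have px' := prime_polyC px; have [x0 _ xP] := px'.
have: divides x%:P (p * r) by exists (b%:P * q); rewrite -e polyCM mulrA.
case/xP => [/prp ux|[r' rE]]; first by case: px => _ /negP [].
apply: IH; exists r'; apply: (mulfI x0).
by rewrite [RHS]mulrCA -rE -e polyCM mulrA.
Qed.

(** The gcd of p and a is taken over the fraction field. If it is constant, a Bezout relation puts a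
    constant multiple of b in (p). Otherwise its primitive part divides p, so it is associated to p,
    and it also divides a. *)
Lemma irreducible_primitive_prime p : (1 < size p)%N -> primitive p ->
  (forall a b, p = a * b -> size a = 1%N \/ size b = 1%N) -> prime_elem p.
Proof.
move=> sp prp irr; have p0 : p != 0 by rewrite -size_poly_gt0 ltnW.
split=> // [|a b dvd].
  by rewrite poly_unitE gtn_eqF.
have [g1|g1] := eqVneq (size (gcdp p a)) 1%N.
  right; have: coprimep p a by rewrite coprimep_def g1.
  case/Bezout_coprimepP=> -[u v] /= /eqpP[[c1 c2] /= /andP[c10 c20] e].
  apply: (primitive_divides c20 prp).
  have -> : c2%:P * b = c1%:P * (u * p * b + v * (a * b)).
    rewrite [v * _]mulrA -mulrDl mulrA [c1%:P * _]mul_polyC e.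
    by rewrite -mul_polyC mulr1.
  apply: divides_mull; apply: divides_add; last exact: divides_mull.
  by exists (u * b); rewrite mulrAC mulrC.
left.
have g0 : gcdp p a != 0 by rewrite gcdp_eq0 negb_and p0.
have [c c0 [g prg gE]] := primitive_decomp g0.
(* The relation [%|] allows a nonzero constant factor, which primitivity of g removes. *)
have dvdg q : gcdp p a %| q -> divides g q.
  case/dvdpP => [[d r] /= d0 e]; apply: (primitive_divides d0 prg).
  exists (c%:P * r).
  by rewrite mul_polyC e gE [LHS]mulrCA [RHS]mulrCA [g * r]mulrC.
have [h pE] := dvdg _ (dvdp_gcdl p a).
have [r aE] := dvdg _ (dvdp_gcdr p a).
have [sg|/eqP/size_poly1P[d d0 hE]] := irr _ _ pE.
  by move: g1; rewrite gE mul_polyC size_scale // sg eqxx.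
have ud : d \is a GRing.unit by apply: prp; exists g; rewrite pE hE mulrC.
exists (d^-1%:P * r); rewrite aE pE hE -mulrA [d%:P * _]mulrA -polyCM divrr //.
by rewrite mul1r.
Qed.

(** Split off the content, then induct on the size: a primitive polynomial is a unit, a prime, or a
    product of two polynomials of smaller size. *)
Lemma factorial_poly : factorial_ring {poly R}.
Proof.
move=> p; move: {2}(size p) (leqnn (size p)) => m.
elim: m p => [|m IH] p.
  by rewrite leqn0 size_poly_eq0 => /eqP ->; rewrite eqxx.
move=> sp p0; have [c c0 [q prq pE]] := primitive_decomp p0.
have [l pc] := facR c0.
suff [j pq] : exists j, prime_prod j q.
  exists (l + j)%N; rewrite pE; apply: prime_prod_mul => //.
  exact: prime_prod_polyC.
have sq : (size q <= m.+1)%N by move: sp; rewrite pE mul_polyC size_scale.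
have q0 : q != 0 by apply: contraNneq p0 => q0; rewrite pE q0 mulr0.
have [s1|s1] := leqP (size q) 1.
  exists 0%N; apply: PrimeProdUnit.
  rewrite (size1_polyC s1) rmorph_unit //; apply: prq; exists 1.
  by rewrite mulr1 -size1_polyC.
have [irr|] := pselect (forall a b, q = a * b -> size a = 1%N \/ size b = 1%N).
  exists 1%N; rewrite -[q]mulr1; apply: PrimeProdMul.
    exact: irreducible_primitive_prime.
  by apply: PrimeProdUnit; rewrite unitr1.
move=> /existsNP[a /existsNP[b /not_implyP[qE /not_orP[/eqP sa /eqP sb]]]].
have := q0; rewrite qE mulf_eq0 negb_or => /andP[a0 b0].
have sab : size q = (size a + size b).-1 by rewrite qE size_mul.
have sa1 : (0 < size a)%N by rewrite size_poly_gt0.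
have sb1 : (0 < size b)%N by rewrite size_poly_gt0.
have [|i pa] := IH a _ a0; first by clear -sq sab sa1 sb1 sa sb; lia.
have [|j pb] := IH b _ b0; first by clear -sq sab sa1 sb1 sa sb; lia.
by exists (i + j)%N; apply: prime_prod_mul.
Qed.

End PolyFactorial.

(** * Transport of factoriality along a bijective ring morphism *)

Section Transport.
Variables (R S : idomainType) (phi : {rmorphism R -> S}).
Hypotheses (phi_inj : injective phi) (phi_surj : forall b, exists a, phi a = b).

Lemma prime_elem_preim x : prime_elem (phi x) -> prime_elem x.
Proof.
case=> x0 /negP ux xP; split.
  by apply: contraNneq x0 => ->; rewrite rmorph0.
  by apply/negP => u; apply: ux; rewrite rmorph_unit.
have pull a : divides (phi x) (phi a) -> divides x a.
  move=> [s]; have [c <-] := phi_surj s; rewrite -rmorphM => /phi_inj ->.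
  by exists c.
move=> a b [c e]; have : divides (phi x) (phi a * phi b).
  by exists (phi c); rewrite -!rmorphM e.
by case/xP => /pull; [left|right].
Qed.

Lemma prime_prod_preim n a : prime_prod n (phi a) -> prime_prod n a.
Proof.
move eb: (phi a) => b pb; elim: pb a eb => [u uu|m x c px _ IH] a e.
  apply: PrimeProdUnit; case/unitrP: uu => v [_ vu]; apply/unitrP.
  have [w wE] := phi_surj v; exists w; suff e1 : a * w = 1 by rewrite mulrC.
  by apply: phi_inj; rewrite rmorphM e wE rmorph1.
have [y yE] := phi_surj x; have [d dE] := phi_surj c.
have -> : a = y * d by apply: phi_inj; rewrite rmorphM e yE dE.
by apply: PrimeProdMul; [apply: prime_elem_preim; rewrite yE|apply: IH].
Qed.

Lemma factorial_ring_preim : factorial_ring S -> factorial_ring R.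
Proof.
move=> facS a a0; have [|n pa] := facS (phi a).
  by apply: contraNneq a0 => e; apply/eqP/phi_inj; rewrite e rmorph0.
by exists n; apply: prime_prod_preim.
Qed.

End Transport.

(** * Factoriality of k[x_1, ..., x_n] and reduced polynomials *)

Section MpolyFactorial.
Variable k : fieldType.

Lemma muniX n m : muni ('X_[m] : {mpoly k[n.+1]}) =
  'X_[[multinom m (widen_ord (leqnSn n) i) | i < n]] *: 'X^(m ord_max).
Proof. by rewrite muniE msuppX big_seq1 mcoeffX eqxx scale1r. Qed.

(** Each coefficient of a can be read off from [muni a], whence injectivity. *)
Lemma mcoeff_muni n (a : {mpoly k[n.+1]}) (m : 'X_{1..n.+1}) :
  (muni a)`_(m ord_max) @_[multinom m (widen_ord (leqnSn n) i) | i < n] = a@_m.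
Proof.
rewrite muniE coef_sum raddf_sum /= [in RHS](mpolyE a) raddf_sum /=.
apply: eq_bigr => m' _; rewrite coefZ coefXn !mcoeffZ mcoeffX.
case: (eqVneq m' m) => [->|neq_m].
  by rewrite eqxx mulr1 mcoeffZ mcoeffX eqxx.
case: (eqVneq (m ord_max) (m' ord_max)) => [e|_]; last first.
  by rewrite !mulr0 mcoeff0.
rewrite mulr1 mcoeffZ mcoeffX; case: eqP => // e'; case/eqP: neq_m.
apply/mnmP => i; case: (unliftP ord_max i) => [j|] -> //.
have := congr1 (fun m : 'X_{1..n} => m j) e'; rewrite !mnmE.
rewrite (_ : lift ord_max j = widen_ord (leqnSn n) j) //.
by apply: val_inj; rewrite /= /bump leqNgt ltn_ord.
Qed.

Lemma muni_inj n : injective (@muni n k).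
Proof.
by move=> a b e; apply/mpolyP => m; rewrite -!mcoeff_muni e.
Qed.

Lemma muni_mwiden n (a : {mpoly k[n]}) : muni (mwiden a) = a%:P.
Proof.
elim/mpolyind: a => [|c m a _ _ IH]; first by rewrite mwiden0 muni0.
rewrite mwidenD muniD IH mwidenZ muniZ mwidenX muniX polyCD; congr (_ + _).
rewrite mnmwiden_ordmax expr0 -!mul_polyC mulr1 -polyCM mul_mpolyC.
congr (_ *: 'X_[_])%:P; apply/mnmP => i; rewrite mnmE.
by rewrite mnmwiden_widen.
Qed.

Lemma muni_surj n (q : {poly {mpoly k[n]}}) : exists a, muni a = q.
Proof.
elim/poly_ind: q => [|q c [a <-]]; first by exists 0; rewrite muni0.
exists (a * 'X_ord_max + mwiden c); rewrite muniD muniM muni_mwiden muniX.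
congr (_ * _ + _); rewrite mnm1E eqxx expr1 -mul_polyC.
rewrite (_ : [multinom _ | i < n] = 0%MM) ?mpolyX0 ?mul1r //.
apply/mnmP => i; rewrite mnmE mnm0E mnm1E.
by rewrite -val_eqE /= gtn_eqF.
Qed.

Lemma factorial_mpoly n : factorial_ring {mpoly k[n]}.
Proof.
elim: n => [|n IH].
  move=> a a0; exists 0%N; apply: PrimeProdUnit.
  have aE := nvar0_mpolyC a.
  rewrite aE rmorph_unit // unitfE; apply: contraNneq a0 => e.
  by rewrite aE e mpolyC0.
exact: (factorial_ring_preim (@muni_inj n) (@muni_surj n) (factorial_poly IH)).
Qed.

Lemma prime_mirreducible n (g : {mpoly k[n]}) : prime_elem g -> mirreducible g.
Proof.
case=> g0 ug gP; split=> // a b gE.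
have unit_r (x y c : {mpoly k[n]}) :
    g = x * y -> x = g * c -> y \is a GRing.unit.
  move=> e xE; have e1 : y * c = 1.
    by apply: (mulfI g0); rewrite mulr1 [RHS]e xE -mulrA [c * y]mulrC.
  by apply/unitrP; exists c; rewrite mulrC.
have: divides g (a * b) by exists 1; rewrite mulr1.
case/gP => [[c /(unit_r _ _ _ gE)]|[c e]]; first by right.
by left; apply: (unit_r b a c) => //; rewrite mulrC.
Qed.

(** Induction on the prime factors of f = x a: by induction g = a r, and x divides g; if x divided a
    then x^2 would divide f, so x divides r. *)
Lemma reduced_divides n (f g : {mpoly k[n]}) m :
  reduced f -> divides f (g ^+ m) -> divides f g.
Proof.
move=> [f0 red]; have [l pf] := factorial_mpoly f0.
(* This form of reducedness passes to the divisors of f, as the induction requires. *)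
have {red f0} : forall x : {mpoly k[n]}, prime_elem x -> ~ divides (x ^+ 2) f.
  by move=> x /prime_mirreducible/red nx [h e]; apply: nx; exists h.
elim: pf => [u uu _ _|j x a px _ IH sqf dvd].
  by exists (u^-1 * g); rewrite mulrA divrr // mul1r.
have [x0 _ xP] := px; have [r gE] : divides a g.
  apply: IH => [y py [h e]|].
    by apply: (sqf y py); rewrite e mulrCA; exists (x * h).
  by case: dvd => c ->; exists (x * c); rewrite mulrCA mulrA.
have: divides x g.
  have: divides x (g ^+ m) by case: dvd => c ->; exists (a * c); rewrite mulrA.
  elim: m {dvd IH} => [|m IHm].
    by rewrite expr0 => /(prime_divides_unit px).
  by rewrite exprS => /xP [].
rewrite gE => /xP[[c aE]|[c ->]]; last by exists c; rewrite mulrCA mulrA.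
by case: (sqf x px); exists c; rewrite aE expr2 mulrA.
Qed.

End MpolyFactorial.

(** * The ideals (x_1^Q, ..., x_n^Q) *)

Section MpolyExtra.
Context {k : fieldType} {n : nat}.
Implicit Types (a b c f g h : {mpoly k[n]}) (m : 'X_{1..n}).

Lemma msizeM_leq a b : (msize (a * b) <= (msize a + msize b).-1)%N.
Proof.
have [->|a0] := eqVneq a 0; first by rewrite mul0r msize0.
have [->|b0] := eqVneq b 0; first by rewrite mulr0 msize0.
by rewrite msizeM.
Qed.

Lemma msize_leP {a l} :
  (forall m, a@_m != 0 -> (mdeg m < l)%N) -> (msize a <= l)%N.
Proof.
move=> H; rewrite msizeE; apply/bigmax_leqP_seq => m m_in _.
by apply: H; rewrite -mcoeff_msupp.
Qed.

Lemma msize_homog {a D} : a \is D.-homog -> (msize a <= D.+1)%N.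
Proof.
move/dhomogP => hom; apply: msize_leP => m.
by rewrite -mcoeff_msupp => /hom /= ->.
Qed.

Lemma msize_mderiv i a : (msize a^`M(i) <= (msize a).-1)%N.
Proof.
apply: msize_leP => m; rewrite mcoeff_deriv => am.
have: (m + U_(i))%MM \in msupp a.
  by rewrite mcoeff_msupp; apply: contraNneq am => ->; rewrite mul0rn.
by move/msize_mdeg_lt; rewrite mdegD mdeg1 addn1; case: (msize a).
Qed.

Lemma mderiv_expn i g l : (g ^+ l)^`M(i) = (g ^+ l.-1 * g^`M(i)) *+ l.
Proof.
elim: l => [|l IH]; first by rewrite expr0 mulr0n -mpolyC1 mderivC.
rewrite exprS mderivM IH mulrnAr mulrC -/(l.+1.-1) mulrS; congr (_ + _).
by case: l {IH} => [|l]; rewrite ?mulr0n //= mulrA -exprS.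
Qed.

Lemma in_power_idealD Q a b :
  in_power_ideal Q a -> in_power_ideal Q b -> in_power_ideal Q (a + b).
Proof.
move=> [s ->] [t ->]; exists (fun i => s i + t i).
by rewrite -big_split; apply: eq_bigr => i _; rewrite mulrDl.
Qed.

Lemma in_power_idealMl Q a b : in_power_ideal Q b -> in_power_ideal Q (a * b).
Proof.
move=> [t ->]; exists (fun i => a * t i).
by rewrite mulr_sumr; apply: eq_bigr => i _; rewrite mulrA.
Qed.

Lemma in_power_idealX Q i : in_power_ideal Q ('X_i ^+ Q : {mpoly k[n]}).
Proof.
exists (fun j => (j == i)%:R); rewrite (bigD1 i) //= eqxx mul1r big1 ?addr0 //.
by move=> j /negbTE ->; rewrite mul0r.
Qed.

Lemma in_power_ideal_homog f d :
  (0 < d)%N -> f \is d.-homog -> in_power_ideal 1 f.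
Proof.
move=> d0 /dhomogP fd; rewrite [f]mpolyE big_seq.
apply: big_ind => [|a b|m /fd /= md].
- by exists (fun=> 0); rewrite big1 // => i _; rewrite mul0r.
- exact: in_power_idealD.
have [i mi] : exists i, m i != 0%N.
  apply/existsP; rewrite -negb_forall; apply: contraTN d0 => /forallP m0.
  by rewrite -md mdegE big1 // => i _; apply/eqP.
have -> : f@_m *: 'X_[m] = (f@_m)%:MP * 'X_[(m - U_(i))%MM] * 'X_i.
  rewrite -mulrA -mpolyXD submK ?mul_mpolyC //.
  by rewrite lep1mP.
by apply: in_power_idealMl; rewrite -['X_i]expr1; apply: in_power_idealX.
Qed.

Lemma in_power_ideal1 Q : (0 < Q)%N -> ~ in_power_ideal Q (1 : {mpoly k[n]}).
Proof.
move=> Q0 [c /(congr1 (meval (fun=> 0)))/eqP]; rewrite meval1 raddf_sum /= big1.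
  by rewrite oner_eq0.
by move=> i _; rewrite mevalM rmorphXn /= mevalXU expr0n gtn_eqF // mulr0.
Qed.

(** The test [Q <= D] is there because [D - Q] truncates at 0. *)
Lemma pihomogMX D Q i a : pihomog mdeg D (a * 'X_i ^+ Q) =
  (if (Q <= D)%N then pihomog mdeg (D - Q) a else 0) * 'X_i ^+ Q.
Proof.
elim/mpolyind: a => [|s m a _ _ IH].
  by rewrite mul0r !pihomog0; case: ifP; rewrite mul0r.
rewrite mulrDl pihomogD IH -scalerAl linearZ /= mpolyXn -mpolyXD pihomogX /=.
rewrite mdegD mdegMn mdeg1 mul1n.
case: leqP => le_QD; last first.
  rewrite !mul0r addr0 gtn_eqF ?scaler0 //.
  by rewrite (leq_trans le_QD) // leq_addl.
rewrite pihomogD linearZ /= mulrDl pihomogX -scalerAl /=; congr (_ *: _ + _).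
rewrite -(eqn_add2r Q (mdeg m)) subnK //.
by case: eqP; rewrite ?mul0r // mpolyXD.
Qed.

(** Take the degree D component of both sides of the relation. Since [msize] is the degree plus one,
    the bound forces [A i] = 0 when Q > D. *)
Lemma in_power_ideal_bounded {D Q h} : h \is D.-homog -> in_power_ideal Q h ->
  exists2 A : 'I_n -> {mpoly k[n]}, h = \sum_(i < n) A i * 'X_i ^+ Q &
    forall i, (msize (A i) <= D.+1 - Q)%N.
Proof.
move=> hD [c hE].
exists (fun i => if (Q <= D)%N then pihomog mdeg (D - Q) (c i) else 0).
  rewrite -(pihomog_dE hD) hE raddf_sum /=; apply: eq_bigr => i _.
  by rewrite pihomogMX.
move=> i; case: (leqP Q D) => QD; last by rewrite msize0.
by rewrite subSn //; apply/msize_homog/pihomogP.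
Qed.

(** If m has degree less than Q, the monomial x_i^Q m is not divisible by x_j^Q for j different from
    i, so nothing can cancel the contribution of C_i. *)
Lemma power_syzygy_eq0 {Q} {C : 'I_n -> {mpoly k[n]}} :
  \sum_(i < n) C i * 'X_i ^+ Q = 0 -> (forall i, msize (C i) <= Q)%N ->
  forall i, C i = 0.
Proof.
move=> C0 sC i; apply/mpolyP => m; rewrite mcoeff0; apply/eqP/negPn/negP => Cm.
have mQ : (mdeg m < Q)%N.
  by apply: leq_trans (sC i); apply: msize_mdeg_lt; rewrite mcoeff_msupp.
case/eqP: Cm; rewrite -(mcoeffMX _ (U_(i) *+ Q)) -mpolyXn.
have /(congr1 (mcoeff (U_(i) *+ Q + m))) := C0.
rewrite mcoeff0 raddf_sum (bigD1 i) //= big1 ?addr0 // => j ji.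
apply/eqP; rewrite mcoeff_eq0 mpolyXn (perm_mem (msuppMX _ _)).
apply/mapP => -[m' _ /mnmP/(_ j)]; rewrite !mnmDE !mulmnE !mnm1E eqxx mul1n.
rewrite eq_sym (negbTE ji) mul0n add0n => mj.
have: (m j <= mdeg m)%N by rewrite mdegE (bigD1 j) //= leq_addr.
by rewrite mj leqNgt (leq_trans mQ) // leq_addr.
Qed.

End MpolyExtra.

(** * Derivations and p-th powers in characteristic p *)

Section Frobenius.
Variables (k : closedFieldType) (p n : nat).
Hypothesis charkp : p \in [pchar k].
Implicit Types (a f g : {mpoly k[n]}) (m : 'X_{1..n}).

Let p_prime : prime p := pcharf_prime charkp.
Let p_gt0 : (0 < p)%N := prime_gt0 p_prime.

Let pchar_mpoly : p \in [pchar {mpoly k[n]}].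
Proof. exact: (rmorph_pchar (@mpolyC n k)). Qed.

Lemma pth_root (c : k) : exists b, b ^+ p = c.
Proof.
have [|b /rootP] := closed_rootP ('X^p - c%:P : {poly k}) _.
  by rewrite size_XnsubC // eqSS -lt0n.
by rewrite !hornerE => /eqP; rewrite subr_eq0 => /eqP; exists b.
Qed.

Lemma sum_exprp (I : Type) (r : seq I) (F : I -> {mpoly k[n]}) :
  (\sum_(i <- r) F i) ^+ p = \sum_(i <- r) F i ^+ p.
Proof.
by rewrite -(pFrobenius_autE pchar_mpoly) rmorph_sum.
Qed.

Lemma expp_inj : injective (fun a => a ^+ p).
Proof.
move=> a b /= /eqP; rewrite -!(pFrobenius_autE pchar_mpoly) -subr_eq0 -rmorphB.
by rewrite /= pFrobenius_autE expf_eq0 p_gt0 subr_eq0 => /eqP.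
Qed.

(** The i-th derivative multiplies the coefficient at m by m_i, so p divides every exponent
    occurring in a. The coefficients have p-th roots, and Frobenius is additive. *)
Lemma mderiv_eq0_exprp a : (forall i, a^`M(i) = 0) -> exists g, a = g ^+ p.
Proof.
move=> da; have dvdm m : m \in msupp a -> forall i, (p %| m i)%N.
  move=> ma i; have [->|mi] := eqVneq (m i) 0%N; first exact: dvdn0.
  have := congr1 (mcoeff (m - U_(i))%MM) (da i).
  rewrite mcoeff_deriv submK ?lep1mP // mnmBE mnm1E eqxx subn1 prednK ?lt0n //.
  rewrite mcoeff0 -mulr_natr => /eqP; rewrite mulf_eq0 -(dvdn_pcharf charkp).
  by move: ma; rewrite mcoeff_msupp => /negbTE ->.
have [r rE] := choice pth_root.
exists (\sum_(m <- msupp a) r a@_m *: 'X_[[multinom (m i %/ p)%N | i < n]]).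
rewrite sum_exprp [LHS]mpolyE !big_seq; apply: eq_bigr => m /dvdm mp.
rewrite exprZn rE mpolyXn; congr (_ *: 'X_[_]); apply/mnmP => i.
by rewrite mulmnE mnmE divnK.
Qed.

Lemma mderiv_Xpower Q i j : (p %| Q)%N -> ('X_i ^+ Q : {mpoly k[n]})^`M(j) = 0.
Proof.
move=> pQ; rewrite mderiv_expn -mulr_natr.
by move: pQ; rewrite (dvdn_pcharf pchar_mpoly) => /eqP ->; rewrite mulr0.
Qed.

(** The operator f D - M D(f) kills f^M and commutes with multiplication by x_i^Q. Applied to the
    relation, it gives a syzygy with coefficients of degree at most d + (dM - Q) - 1 < Q. *)
Lemma power_ideal_coef_deriv f d M Q (A : 'I_n -> {mpoly k[n]}) :
  f \is d.-homog -> (p %| Q)%N -> (d * M.+1 <= 2 * Q)%N ->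
  f ^+ M = \sum_(i < n) A i * 'X_i ^+ Q ->
  (forall i, msize (A i) <= (d * M).+1 - Q)%N ->
  forall i j, f * (A i)^`M(j) = (f^`M(j) * A i) *+ M.
Proof.
move=> fd pQ le_dQ fM sA i j; apply/eqP; rewrite -subr_eq0; apply/eqP.
pose C i := f * (A i)^`M(j) - (f^`M(j) * A i) *+ M.
have sf := msize_homog fd.
apply: (@power_syzygy_eq0 _ _ Q C) => [|{}i].
  rewrite (eq_bigr (fun i => f * (A i * 'X_i ^+ Q)^`M(j) -
    (f^`M(j) * (A i * 'X_i ^+ Q)) *+ M)) => [|{}i _]; last first.
    rewrite mderivM mderiv_Xpower // mulr0 addr0 /C mulrBl -!mulrA.
    by rewrite mulrnAl -mulrA.
  rewrite big_split /= sumrN sumrMnl -!mulr_sumr -raddf_sum /= -fM.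
  rewrite mderiv_expn; case: (M) => [|l]; first by rewrite !mulr0n mulr0 subrr.
  by rewrite mulrnAr mulrA -exprS mulrC subrr.
(* For [A i] = 0 the bound [sA i] carries no information, the subtraction being truncated; otherwise
   it forces Q <= dM. *)
rewrite /C; have [->|A0] := eqVneq (A i) 0.
  by rewrite mderiv0 !mulr0 mul0rn subrr msize0.
have A1 : (0 < msize (A i))%N by rewrite lt0n msize_poly_eq0.
have sAi := sA i.
have le_C : ((d + msize (A i)).-1 <= Q)%N.
  by move: le_dQ; rewrite mulnS; clear -A1 sAi; lia.
apply: msize_leP => m; apply: contraNT; rewrite -leqNgt => Qm.
have coef0 b : (msize b <= Q)%N -> b@_m = 0.
  by move=> sb; apply/memN_msupp_eq0/msize_mdeg_ge/(leq_trans sb).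
have sAj := msize_mderiv j (A i); have sfj := msize_mderiv j f.
have sM1 := msizeM_leq f (A i)^`M(j); have sM2 := msizeM_leq f^`M(j) (A i).
have [sC1 sC2] :
    (msize (f * (A i)^`M(j)) <= Q)%N /\ (msize (f^`M(j) * A i) <= Q)%N.
  move: A1 le_C sf sAj sfj sM1 sM2; clear.
  move: (msize (f * _)) (msize (_ * A i)) (msize f) (msize f^`M(j)) => ? ? ? ?.
  by move: (msize (A i)) (msize (A i)^`M(j)) => *; lia.
by rewrite mcoeffB mcoeffMn !coef0 // mul0rn subrr.
Qed.

Lemma power_ideal_coef_exprp f d M Q (A : 'I_n -> {mpoly k[n]}) :
  f \is d.-homog -> reduced f -> (p %| Q)%N -> (d * M.+1 <= 2 * Q)%N ->
  f ^+ M = \sum_(i < n) A i * 'X_i ^+ Q ->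
  (forall i, msize (A i) <= (d * M).+1 - Q)%N ->
  forall i, exists a, A i = f ^+ (M %% p) * a ^+ p.
Proof.
move=> fd red pQ le_dQ fM sA i; set r := (M %% p)%N.
have lt_rp : (r < p)%N by rewrite ltn_mod.
have [f0 _] := red.
(* By the previous lemma, the derivative is (p - r + M) f^(p-r-1) D(f) A_i, and p divides p - r +
   M. *)
have [g gE] : exists g, f ^+ (p - r) * A i = g ^+ p.
  apply: mderiv_eq0_exprp => j.
  have /prednK <- : (0 < p - r)%N by rewrite subn_gt0.
  rewrite mderivM mderiv_expn /= mulrnAl -mulrA exprSr -[_ * f * _]mulrA.
  rewrite (power_ideal_coef_deriv fd pQ le_dQ fM sA) mulrnAr -mulrnDr.
  rewrite prednK ?subn_gt0 // -mulr_natr.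
  suff /eqP -> : (p - r + M)%:R == 0 :> {mpoly k[n]} by rewrite mulr0.
  rewrite -(dvdn_pcharf pchar_mpoly) (divn_eq M p) addnCA subnK 1?ltnW //.
  by rewrite dvdn_add // dvdn_mull.
(* Since p - r > 0, f divides g^p. *)
have [h hE] : divides f g.
  apply: (reduced_divides (m := p) red); rewrite -gE -(prednK p_gt0) subSn.
    by exists (f ^+ (p.-1 - r) * A i); rewrite exprS mulrA.
  by rewrite -ltnS prednK.
exists h; apply: (mulfI (expf_neq0 (p - r) f0)).
by rewrite gE hE exprMn mulrA -exprD subnK // ltnW.
Qed.

Lemma power_notin_power_ideal f d N q s :
  f \is d.-homog -> reduced f -> (0 < q)%N -> (p %| q)%N ->
  (0 < N <= p)%N -> (d * N <= 2 * q)%N ->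
  ~ in_power_ideal (q * p ^ s) (f ^+ (N * p ^ s).-1).
Proof.
move=> fd red q0 pq /andP[N0 Np] le_dq; have [f0 _] := red.
elim: s => [|s IH] /(in_power_ideal_bounded (dhomogMn _ fd)) [A fE sA].
  (* Here [N <= p] matters: the exponent is its own residue, so the whole power of f can be
     cancelled. *)
  have M_mod : ((N * p ^ 0).-1 %% p = (N * p ^ 0).-1)%N.
    by rewrite expn0 muln1 modn_small // prednK.
  have [||a aE] := choice (power_ideal_coef_exprp fd red _ _ fE sA).
  - by rewrite expn0 muln1.
  - by rewrite expn0 !muln1 prednK.
  apply: (@in_power_ideal1 k n q) => //; exists (fun i => a i ^+ p).
  apply: (mulfI (expf_neq0 (N * p ^ 0).-1 f0)); rewrite mulr1 [LHS]fE mulr_sumr.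
  by apply: eq_bigr => i _; rewrite aE M_mod expn0 !muln1 mulrA.
have P0 : (0 < N * p ^ s)%N by rewrite muln_gt0 N0 expn_gt0 p_gt0.
(* Thus the power of f at s + 1 is f^(p-1) times the p-th power of the one at s. *)
have ME : ((N * p ^ s.+1).-1 = (N * p ^ s).-1 * p + p.-1)%N.
  by rewrite expnS; clear -P0 p_gt0; nia.
have M_mod : ((N * p ^ s.+1).-1 %% p = p.-1)%N.
  by rewrite ME modnMDl modn_small // prednK.
have [||a aE] := choice (power_ideal_coef_exprp fd red _ _ fE sA).
- by rewrite dvdn_mulr.
- rewrite prednK ?muln_gt0 ?N0 ?expn_gt0 ?p_gt0 //.
  by rewrite !mulnA leq_mul2r le_dq orbT.
apply: IH; exists a; apply: expp_inj; rewrite sum_exprp.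
apply: (mulfI (expf_neq0 p.-1 f0)).
rewrite -exprM -exprD addnC -ME fE mulr_sumr.
apply: eq_bigr => i _; rewrite aE M_mod exprMn -exprM -mulnA -expnSr mulrA //.
Qed.

(** Frobenius carries (x_1, ..., x_n), which contains f, into its Frobenius powers. This bounds by 1
    the set whose supremum is [fpt]. *)
Lemma power_in_power_ideal f d N s :
  f \is d.-homog -> (0 < d)%N -> (p ^ s <= N)%N ->
  in_power_ideal (p ^ s) (f ^+ N).
Proof.
move=> fd d0 /subnK <-; rewrite exprD; apply: in_power_idealMl.
elim: s => [|s [a fE]].
  by rewrite expn0 expr1; apply: in_power_ideal_homog fd.
exists (fun i => a i ^+ p); rewrite expnSr exprM fE sum_exprp.
by apply: eq_bigr => i _; rewrite exprMn -exprM.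
Qed.

End Frobenius.

(** * The threshold *)

Lemma trunc_base_ratio (R : realType) (p e a d : nat) :
  (0 < p)%N -> (0 < d)%N ->
  trunc_base p e (a%:R / d%:R : R) = ((a * p ^ e) %/ d)%:R / (p ^ e)%:R.
Proof.
move=> p0 d0; rewrite /trunc_base; congr (_ / _).
have d0' : 0 < d%:R :> R by rewrite ltr0n.
rewrite (floor_def (m := ((a * p ^ e) %/ d)%N%:Z)) //.
rewrite -PoszD -!pmulrn mulrA -natrM ler_pdivlMr // ltr_pdivrMr // mulnC.
by rewrite -!natrM ler_nat ltr_nat leq_divM addn1 ltn_ceil.
Qed.

(** The fractions (N p^s - 1) / p^(e+s) belong to the set defining [fpt] and tend to N / p^e. *)
Lemma fpt_ge (R : realType) (k : closedFieldType) (p n d N e : nat)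
  (f : {mpoly k[n]}) : p \in [pchar k] -> f \is d.-homog -> (0 < d)%N ->
  (forall s, ~ in_power_ideal (p ^ e * p ^ s) (f ^+ (N * p ^ s).-1)) ->
  N%:R / (p ^ e)%:R <= fpt R p f.
Proof.
move=> charkp fd d0 fN; have p_prime := pcharf_prime charkp.
have p0 i : 0 < (p ^ i)%:R :> R by rewrite ltr0n expn_gt0 prime_gt0.
apply/ler_addgt0Pr => eps eps0.
have [s sP] : exists s, (p ^ s)%:R^-1 <= eps.
  exists (Num.bound eps^-1); rewrite -[leRHS]invrK lef_pV2 ?posrE ?invr_gt0 //.
  apply: le_trans (ltW (archi_boundP _)) _; first by rewrite invr_ge0 ltW.
  by rewrite ler_nat ltnW // ltn_expl // prime_gt1.
(* The gap is at most 1 / p^(e+s), here relaxed to 1 / p^s. *)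
apply: (@le_trans _ _ ((N * p ^ s).-1%:R / (p ^ (e + s))%:R + (p ^ s)%:R^-1)).
  rewrite expnD natrM ler_pdivrMr //.
  have divDE (x y z : R) : 0 < y -> 0 < z ->
      (x / (y * z) + z^-1) * y = (x + y) / z.
    move=> y0 z0; rewrite mulrDl [y * z]mulrC invfM !mulrA divfK ?gt_eqF //.
    by rewrite mulrDl [_^-1 * _]mulrC.
  rewrite divDE ?p0 // ler_pdivlMr // -natrM.
  apply: (@le_trans _ _ ((N * p ^ s).-1%:R + 1)).
    by rewrite natr1 ler_nat leqSpred.
  by rewrite lerD2l ler1n expn_gt0 prime_gt0.
apply: lerD sP; apply: ub_le_sup.
  exists 1 => _ [M [i [-> fM]]]; rewrite ler_pdivrMr // mul1r ler_nat ltnW //.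
  by rewrite ltnNge; apply/negP => /(power_in_power_ideal charkp fd d0)/fM.
by exists (N * p ^ s).-1, (e + s)%N; rewrite expnD.
Qed.

Theorem proposition8p1 (R : realType) (k : closedFieldType) (p : nat)
  (charkp : p \in [pchar k]) (n : nat) (n_ge2 : (2 <= n)%N)
  (d : nat) (d_ge2 : (2 <= d)%N)
  (f : {mpoly k[n]}) (f_homog : f \is d.-homog) (f_reduced : reduced f)
  (e : nat) (e_gt0 : (0 < e)%N)
  (e_nonzero : trunc_base p e (2%:R / d%:R : R) <> 0)
  (e_min : forall e' : nat, (0 < e')%N ->
     trunc_base p e' (2%:R / d%:R : R) <> 0 -> (e <= e')%N) :
  trunc_base p e (2%:R / d%:R) <= fpt R p f.
Proof.
have d0 : (0 < d)%N := ltnW d_ge2.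
have p0 : (0 < p)%N by rewrite prime_gt0 // (pcharf_prime charkp).
rewrite trunc_base_ratio // in e_nonzero *; set N := (_ %/ d)%N in e_nonzero *.
apply: (fpt_ge _ charkp f_homog d0) => s.
apply: (power_notin_power_ideal charkp f_homog f_reduced).
- by rewrite expn_gt0 p0.
- by rewrite dvdn_exp.
- apply/andP; split.
    by rewrite lt0n; apply/eqP => N0; apply: e_nonzero; rewrite N0 mul0r.
  (* For e = 1 this is d >= 2. For larger e, minimality makes the truncation at e - 1 vanish, that
     is 2 p^(e-1) < d. *)
  suff: (2 * p ^ e <= p * d)%N by move/(leq_div2r d); rewrite mulnK.
  case: e e_gt0 @N {e_nonzero} e_min => // -[|e] _ _ e_min.
    by rewrite expn1 mulnC leq_mul2l d_ge2 orbT.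
  have [le_d|le_d] := ltnP (2 * p ^ e.+1) d.
    by rewrite expnS mulnCA leq_mul2l ltnW ?orbT.
  suff: (e.+1 < e.+1)%N by rewrite ltnn.
  apply: e_min => //; rewrite trunc_base_ratio //; apply/eqP.
  rewrite mulf_neq0 ?invr_eq0 ?pnatr_eq0 -?lt0n ?divn_gt0 //.
  by rewrite expn_gt0 p0.
- by rewrite mulnC /N leq_divM.
Qed.
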